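(* Let $S$ be a semigroup, let $E$ be a set of idempotents of $S$, and assume that $S$ is a reduced $E$-Fountain semigroup which satisfies the congruence condition and the generalized right ample identity. Then the category $\mathcal{C}(S)^{\mathrm{op}}$ is isomorphic to the category $\mathcal{D}(S)$.
   Context: For a semigroup $S$ and a subset $E$ of idempotents of $S$, define equivalence relations on $S$: $a\,\widetilde{\mathcal{L}}_E\,b$ iff for all $e\in E$ ($ae=a\iff be=b$); $a\,\widetilde{\mathcal{R}}_E\,b$ iff for all $e\in E$ ($ea=a\iff eb=b$). $S$ is $E$-Fountain if every $\widetilde{\mathcal{L}}_E$-class and every $\widetilde{\mathcal{R}}_E$-class contains an element of $E$. It is reduced if moreover $ef=e\iff fe=e$ for all $e,f\in E$. In that case each $\widetilde{\mathcal{L}}_E$-class (resp. $\widetilde{\mathcal{R}}_E$-class) contains a unique element of $E$; the one in the $\widetilde{\mathcal{L}}_E$-class (resp. $\widetilde{\mathcal{R}}_E$-class) of $a\in S$ is denoted $a^{\ast}$ (resp. $a^{+}$). $S$ satisfies the congruence condition if $\widetilde{\mathcal{L}}_E$ is a right congruence and $\widetilde{\mathcal{R}}_E$ is a left congruence; equivalently $(ab)^{\ast}=(a^{\ast}b)^{\ast}$ and $(ab)^{+}=(ab^{+})^{+}$ for all $a,b\in S$. The generalized right ample identity holds in $S$ if $\left(e\left(a(eaf)^{\ast}\right)^{+}\right)^{\ast}=\left(a(eaf)^{\ast}\right)^{+}$ for all $a\in S$ and $e,f\in E$. The category $\mathcal{C}(S)$ (defined under the congruence condition): its objects are the elements of $E$;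 its morphisms are in one-to-one correspondence with elements of $S$, where $a\in S$ corresponds to a morphism $C(a)$ with domain $a^{\ast}$ and range $a^{+}$; if $b^{\ast}=a^{+}$ the composition is $C(b)\cdot C(a)=C(ba)$. A partial left $S$-action on a set $X$ is a semigroup homomorphism from $S$ to the monoid of partial functions on $X$ (composed right to left); write $s\cdot x$ for the (possibly undefined) result. A function $f:X\to Y$ between partial left $S$-actions is a homomorphism if for all $x\in X$, $s\in S$: $s\cdot x$ is defined iff $s\cdot f(x)$ is defined, and in that case $f(s\cdot x)=s\cdot f(x)$. For $e\in E$, $\widetilde{\mathcal{L}}_E(e)$ is the $\widetilde{\mathcal{L}}_E$-class of $e$; it is a partial left $S$-action via $s\cdot x=sx$ if $sx\in\widetilde{\mathcal{L}}_E(e)$, and undefined otherwise. The category $\mathcal{D}(S)$: its objects are the sets $\widetilde{\mathcal{L}}_E(e)$ for $e\in E$; the morphisms from $\widetilde{\mathcal{L}}_E(e)$ to $\widetilde{\mathcal{L}}_E(f)$ are all homomorphisms of partial left $S$-actions $F:\widetilde{\mathcal{L}}_E(e)\to\widetilde{\mathcal{L}}_E(f)$, with composition of functions (right to left). *)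

(* Defs.v *)
From HB Require Import structures.
From mathcomp Require Import all_boot boolp classical_sets.

Set Implicit Arguments.
Unset Strict Implicit.
Unset Printing Implicit Defensive.

Local Open Scope group_scope.

Record category := Category {
  obj :> Type;
  hom : obj -> obj -> Type;
  idm : forall x, hom x x;
  comp : forall x y z, hom y z -> hom x y -> hom x z;
  comp1m : forall x y (f : hom x y), comp (idm y) f = f;
  compm1 : forall x y (f : hom x y), comp f (idm x) = f;
  compA : forall x y z t (h : hom z t) (g : hom y z) (f : hom x y),
    comp h (comp g f) = comp (comp h g) f }.

Arguments idm {c} x.
Arguments comp {c x y z} _ _.

Definition opposite (C : category) : category :=
  @Category C (fun x y => hom y x) (@idm C) (fun x y z g f => comp f g)
    (fun x y => @compm1 C y x) (fun x y => @comp1m C y x)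
    (fun x y z t h g f => esym (compA f g h)).

Record functor (C D : category) := Functor {
  fobj :> C -> D;
  fmap : forall x y, hom x y -> hom (fobj x) (fobj y);
  fmap1 : forall x, fmap (idm x) = idm (fobj x);
  fmapM : forall x y z (g : hom y z) (f : hom x y),
    fmap (comp g f) = comp (fmap g) (fmap f) }.

Arguments fmap {C D} _ {x y} _.

Definition functor_id (C : category) : functor C C :=
  @Functor C C id (fun _ _ => id) (fun _ => erefl) (fun _ _ _ _ _ => erefl).

Section FunctorComp.
Variables (A B C : category) (G : functor B C) (F : functor A B).

Lemma functor_comp1 x : fmap G (fmap F (idm x)) = idm (G (F x)).
Proof. by rewrite !fmap1. Qed.

Lemma functor_compM x y z (g : hom y z) (f : hom x y) :
  fmap G (fmap F (comp g f)) =
  comp (fmap G (fmap F g)) (fmap G (fmap F f)).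
Proof. by rewrite !fmapM. Qed.

Definition functor_comp : functor A C :=
  @Functor A C (fun x => G (F x)) (fun x y f => fmap G (fmap F f))
    functor_comp1 functor_compM.
End FunctorComp.

Definition isomorphic_categories (C D : category) : Prop :=
  exists (F : functor C D) (G : functor D C),
    functor_comp G F = functor_id C /\ functor_comp F G = functor_id D.

Section Fountain.
Variables (S : semigroupType) (E : set S).
Implicit Types (a b c : S).

Definition Ltilde a b : Prop := forall e, E e -> (a * e = a <-> b * e = b).
Definition Rtilde a b : Prop := forall e, E e -> (e * a = a <-> e * b = b).

Definition fountain : Prop :=
  (forall a, exists2 e, E e & Ltilde a e) /\
  (forall a, exists2 e, E e & Rtilde a e).

Record reduced_fountain : Prop := ReducedFountain {
  fountain_idem : forall e, E e -> e * e = e;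
  fountainP : fountain;
  fountain_reduced : forall e f, E e -> E f -> (e * f = e <-> f * e = e) }.

Definition congruence_condition : Prop :=
  (forall a b c, Ltilde a b -> Ltilde (a * c) (b * c)) /\
  (forall a b c, Rtilde a b -> Rtilde (c * a) (c * b)).

Hypothesis HE : reduced_fountain.

(* [star a] and [plus a] are a^* and a^+; [star_unique] and [plus_unique]
   below show that the choices made here are forced. *)
Definition star a : S := s2val (cid2 ((fountainP HE).1 a)).
Definition plus a : S := s2val (cid2 ((fountainP HE).2 a)).

Lemma starE a : E (star a).
Proof. exact: s2valP. Qed.

Lemma plusE a : E (plus a).
Proof. exact: s2valP. Qed.

Lemma star_Ltilde a : Ltilde a (star a).
Proof. exact: s2valP'. Qed.

Lemma plus_Rtilde a : Rtilde a (plus a).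
Proof. exact: s2valP'. Qed.

Lemma star_unique a e : E e -> Ltilde a e -> e = star a.
Proof.
move=> Ee ae; have Ef := starE a; have af := star_Ltilde a.
have ee := fountain_idem HE Ee; have ff := fountain_idem HE Ef.
have ef : e * star a = e by apply/(ae _ Ef)/(af _ Ef).
have fe : star a * e = star a by apply/(af _ Ee)/(ae _ Ee).
by rewrite -ef; apply/(fountain_reduced HE Ef Ee).
Qed.

Lemma plus_unique a e : E e -> Rtilde a e -> e = plus a.
Proof.
move=> Ee ae; have Ef := plusE a; have af := plus_Rtilde a.
have ee := fountain_idem HE Ee; have ff := fountain_idem HE Ef.
have fe : plus a * e = e by apply/(ae _ Ef)/(af _ Ef).
have ef : e * plus a = plus a by apply/(af _ Ee)/(ae _ Ee).
by rewrite -ef; apply/esym/(fountain_reduced HE Ee Ef).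
Qed.

Definition generalized_right_ample : Prop :=
  forall a e f, E e -> E f ->
    star (e * plus (a * star (e * a * f))) = plus (a * star (e * a * f)).

Lemma star_id e : E e -> star e = e.
Proof. by move=> Ee; apply/esym/star_unique. Qed.

Lemma plus_id e : E e -> plus e = e.
Proof. by move=> Ee; apply/esym/plus_unique. Qed.

Lemma mul_star a : a * star a = a.
Proof.
by apply/(star_Ltilde a (starE a))/(fountain_idem HE (starE a)).
Qed.

Lemma mul_plus a : plus a * a = a.
Proof.
by apply/(plus_Rtilde a (plusE a))/(fountain_idem HE (plusE a)).
Qed.

Hypothesis HC : congruence_condition.

Lemma starM b a : star (b * a) = star (star b * a).
Proof.
apply: star_unique (starE _) _ => e Ee.
rewrite -(star_Ltilde (b * a) Ee).
by apply: iff_sym; apply: (HC.1 _ _ _ _ e Ee) => f Ef; rewrite (star_Ltilde b Ef).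
Qed.

Lemma plusM b a : plus (b * a) = plus (b * plus a).
Proof.
apply: plus_unique (plusE _) _ => e Ee.
rewrite -(plus_Rtilde (b * a) Ee).
by apply: iff_sym; apply: (HC.2 _ _ _ _ e Ee) => f Ef; rewrite (plus_Rtilde a Ef).
Qed.

Definition C_hom (e f : E) : Type :=
  {a : S | star a = val e /\ plus a = val f}.

Lemma C_idP (e : E) : star (val e) = val e /\ plus (val e) = val e.
Proof. by have Ee := set_valP e; split; [apply: star_id|apply: plus_id]. Qed.

Definition C_id (e : E) : C_hom e e := exist _ (val e) (C_idP e).

Lemma C_compP (e f g : E) (b : C_hom f g) (a : C_hom e f) :
  star (sval b * sval a) = val e /\ plus (sval b * sval a) = val g.
Proof.
case: a b => [a [sa pa]] [b [sb pb]] /=.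
by split; [rewrite starM sb -pa mul_plus | rewrite plusM pa -sb mul_star].
Qed.

Definition C_comp (e f g : E) (b : C_hom f g) (a : C_hom e f) : C_hom e g :=
  exist _ (sval b * sval a) (C_compP b a).

Lemma C_comp1m e f (a : C_hom e f) : C_comp (C_id f) a = a.
Proof.
by case: a => a [sa pa]; apply: eq_exist; rewrite /= -pa mul_plus.
Qed.

Lemma C_compm1 e f (a : C_hom e f) : C_comp a (C_id e) = a.
Proof.
by case: a => a [sa pa]; apply: eq_exist; rewrite /= -sa mul_star.
Qed.

Lemma C_compA e f g h (c : C_hom g h) (b : C_hom f g) (a : C_hom e f) :
  C_comp c (C_comp b a) = C_comp (C_comp c b) a.
Proof. by apply: eq_exist; rewrite /= mulgA. Qed.

Definition C_category : category := Category C_comp1m C_compm1 C_compA.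

End Fountain.

Definition pfun_comp X Y Z (g : Y -> option Z) (f : X -> option Y) :
  X -> option Z := fun x => obind g (f x).

Record partial_action (S : semigroupType) := PartialAction {
  pcarrier :> Type;
  pact : S -> pcarrier -> option pcarrier;
  pactM : forall s t, pact (s * t) = pfun_comp (pact s) (pact t) }.

Arguments pact {S} p _ _.

Definition is_pact_hom (S : semigroupType) (X Y : partial_action S)
    (F : X -> Y) : Prop :=
  forall (s : S) (x : X),
    (isSome (pact X s x) <-> isSome (pact Y s (F x))) /\
    (forall y, pact X s x = Some y -> pact Y s (F x) = Some (F y)).

Section PactHom.
Variable S : semigroupType.
Implicit Types X Y Z T : partial_action S.

Definition pact_hom X Y : Type := {F : X -> Y | is_pact_hom F}.

Lemma pact_idP X : is_pact_hom (@id X).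
Proof. by move=> s x; split. Qed.

Definition pact_id X : pact_hom X X := exist _ id (@pact_idP X).

Lemma pact_compP X Y Z (G : pact_hom Y Z) (F : pact_hom X Y) :
  is_pact_hom (sval G \o sval F).
Proof.
case: F G => [F HF] [G HG] s x /=; have [F1 F2] := HF s x.
have [G1 G2] := HG s (F x); split; first exact: iff_trans F1 G1.
by move=> y /F2/G2.
Qed.

Definition pact_comp X Y Z (G : pact_hom Y Z) (F : pact_hom X Y) :
  pact_hom X Z := exist _ (sval G \o sval F) (pact_compP G F).

Lemma pact_comp1m X Y (F : pact_hom X Y) : pact_comp (pact_id Y) F = F.
Proof. by case: F => F HF; apply: eq_exist. Qed.

Lemma pact_compm1 X Y (F : pact_hom X Y) : pact_comp F (pact_id X) = F.
Proof. by case: F => F HF; apply: eq_exist. Qed.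

Lemma pact_compA X Y Z T (H : pact_hom Z T) (G : pact_hom Y Z)
    (F : pact_hom X Y) :
  pact_comp H (pact_comp G F) = pact_comp (pact_comp H G) F.
Proof. exact: eq_exist. Qed.

End PactHom.

Section DCategory.
Variables (S : semigroupType) (E : set S).

Definition Ltilde_class (e : S) : set S := [set a | Ltilde E a e].

(* The objects are the classes themselves, as subsets of [S]. *)
Record D_obj := DObj {
  D_set :> set S;
  D_setP : exists2 e, E e & D_set = Ltilde_class e }.

(* [insub (s * val x)] is [Some] of [s * val x] if it lies in [X], and [None]
   otherwise. *)
Definition Ltilde_act (X : D_obj) (s : S) (x : X) : option X :=
  insub (s * val x).

Lemma Ltilde_actM (X : D_obj) (s t : S) :
  @Ltilde_act X (s * t) = pfun_comp (@Ltilde_act X s) (@Ltilde_act X t).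
Proof.
have key y : D_set X y -> D_set X (s * t * y) -> D_set X (t * y).
  case: (D_setP X) => e Ee -> ye sty f Ef.
  split=> [tyf|/(ye _ Ef) yf]; last by rewrite -mulgA yf.
  by apply/(sty _ Ef); rewrite -!mulgA [t * _]mulgA tyf.
apply/funext => x; rewrite /Ltilde_act /pfun_comp.
case: (insubP X (t * val x)) => [u _ uE /=|tx].
  by rewrite uE mulgA.
apply: insubN; apply: contraNN tx; rewrite !inE.
exact/key/set_valP.
Qed.

Definition Ltilde_action (X : D_obj) : partial_action S :=
  PartialAction (@Ltilde_actM X).

Definition D_hom (X Y : D_obj) : Type :=
  pact_hom (Ltilde_action X) (Ltilde_action Y).

Definition D_category : category :=
  @Category D_obj D_hom
    (fun X => pact_id (Ltilde_action X))
    (fun X Y Z G F => pact_comp G F)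
    (fun X Y F => pact_comp1m F)
    (fun X Y F => pact_compm1 F)
    (fun X Y Z T H G F => pact_compA H G F).

End DCategory.

(* Main.v *)
Require Import Defs.
From mathcomp Require Import all_boot boolp classical_sets.

Set Implicit Arguments.
Unset Strict Implicit.
Unset Printing Implicit Defensive.

Local Open Scope group_scope.

(** The isomorphism sends the object [e] to its class and the morphism
[a : e -> f] of C(S), that is [a^* = e] and [a^+ = f], to the right
multiplication [x |-> x * a] from the class of [f] to the class of [e].

Right multiplication lands in the class of [e] by the congruence condition, and
it obviously commutes with the left action; what has to be shown is that it
reflects definedness: if [(t * a)^* = a^*] with [t * a^+ = t], then
[t^* = a^+]. This is [star_cancel], and it is exactly what the generalized
right ample identity provides.

Conversely, let [F] be a morphism from the class of [f] to the class of [e].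
Every [x] in the class of [f] is [x * f], so [F x = x * F f]: thus [F] is right
multiplication by [a = F f] ([hom_rmul]). The value [a] is a morphism of C(S)
from [e] to [f]: [a^* = e] holds since [a] is in the class of [e], and
[a^+ = f] follows from definedness being reflected ([hom_unit_plus]). So the
functor is full, and it is faithful because [f * a = a].

On objects the functor is bijective since a class contains a unique element of
[E]. Strict isomorphism then follows from the general fact that a fully
faithful functor which is bijective on objects is an isomorphism
([fully_faithful_iso]). *)

(** * Isomorphisms of categories from fully faithful functors *)

Section HomCast.
Variable C : category.
Implicit Types x y : C.

(** Functors that agree on objects only propositionally have morphism maps of
different types; they are compared along this transport. *)
Definition hom_cast x x' y y' (p : x = x') (q : y = y') (f : hom x y) :
    hom x' y' :=
  ecast z (hom x' z) q (ecast z (hom z y) p f).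

(** Loops are trivial by proof irrelevance, so a transport depends only on its
endpoints. *)
Lemma hom_cast_id x y (p : x = x) (q : y = y) (f : hom x y) :
  hom_cast p q f = f.
Proof. by rewrite (Prop_irrelevance p erefl) (Prop_irrelevance q erefl). Qed.

Lemma hom_cast_trans x x' x'' y y' y'' (p : x = x') (p' : x' = x'')
    (q : y = y') (q' : y' = y'') (f : hom x y) :
  hom_cast p' q' (hom_cast p q f) = hom_cast (etrans p p') (etrans q q') f.
Proof. by case: x'' / p'; case: y'' / q'. Qed.

Lemma hom_cast1 x x' (p : x = x') : hom_cast p p (idm x) = idm x'.
Proof. by case: x' / p. Qed.

Lemma hom_castM x x' y y' z z' (p : x = x') (q : y = y') (r : z = z')
    (g : hom y z) (f : hom x y) :
  hom_cast p r (Defs.comp g f) = Defs.comp (hom_cast q r g) (hom_cast p q f).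
Proof. by case: x' / p; case: y' / q; case: z' / r. Qed.

End HomCast.

Lemma fmap_cast (C D : category) (F : functor C D) (x x' y y' : C)
    (p : x = x') (q : y = y') (f : hom x y) :
  fmap F (hom_cast p q f) = hom_cast (congr1 F p) (congr1 F q) (fmap F f).
Proof. by case: x' / p; case: y' / q. Qed.

Lemma functor_ext (C D : category) (F G : functor C D)
    (FG : forall x, F x = G x) :
  (forall x y (f : hom x y), hom_cast (FG x) (FG y) (fmap F f) = fmap G f) ->
  F = G.
Proof.
case: F G FG => [F mF F1 FM] [G mG G1 GM] /= FG.
have eFG : F = G by apply/funext.
move: mG G1 GM FG; case: G / eFG => mG G1 GM FG mFG.
have eq_m : mF = mG.
  apply: functional_extensionality_dep => x.
  apply: functional_extensionality_dep => y.
  by apply/funext => f; rewrite -mFG hom_cast_id.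
move: G1 GM mFG; case: mG / eq_m => G1 GM _.
by rewrite (Prop_irrelevance F1 G1) (Prop_irrelevance FM GM).
Qed.

Section FullyFaithful.
Variables (C D : category) (F : functor C D) (g : D -> C).
Hypotheses (gK : forall X, F (g X) = X) (F_inj : injective F).
Hypothesis F_faithful : forall x y : C, injective (@fmap C D F x y).
Hypothesis F_full :
  forall (x y : C) (h : hom (F x) (F y)), exists f, fmap F f = h.

Definition lift_hom (x y : C) (h : hom (F x) (F y)) : hom x y :=
  sval (cid (F_full h)).

Lemma lift_homK x y (h : hom (F x) (F y)) : fmap F (lift_hom h) = h.
Proof. exact: svalP (cid (F_full h)). Qed.

(** [g] inverts [F] on objects only up to [gK], so [h] is first transported to a
morphism between objects in the image of [F]. *)
Definition inverse_map (X Y : D) (h : hom X Y) : hom (g X) (g Y) :=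
  lift_hom (hom_cast (esym (gK X)) (esym (gK Y)) h).

Lemma inverse_map1 X : inverse_map (idm X) = idm (g X).
Proof. by apply: F_faithful; rewrite lift_homK fmap1 hom_cast1. Qed.

Lemma inverse_mapM X Y Z (k : hom Y Z) (h : hom X Y) :
  inverse_map (Defs.comp k h) = Defs.comp (inverse_map k) (inverse_map h).
Proof.
by apply: F_faithful; rewrite fmapM !lift_homK (hom_castM _ (esym (gK Y))).
Qed.

Definition inverse_functor : functor D C := Functor inverse_map1 inverse_mapM.

Lemma fully_faithful_iso : isomorphic_categories C D.
Proof.
have Fg x : g (F x) = x by apply: F_inj; rewrite gK.
exists F, inverse_functor; split.
  apply: (@functor_ext _ _ (functor_comp inverse_functor F) (functor_id C) Fg)
    => x y f; apply: F_faithful => /=.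
  by rewrite fmap_cast lift_homK hom_cast_trans hom_cast_id.
apply: (@functor_ext _ _ (functor_comp F inverse_functor) (functor_id D) gK)
  => X Y h /=.
by rewrite lift_homK hom_cast_trans hom_cast_id.
Qed.

End FullyFaithful.

(** * The classes of idempotents as objects *)

Section RightMultiplication.
Variables (S : semigroupType) (E : set S).
Hypothesis HE : reduced_fountain E.
Hypothesis HC : congruence_condition E.
Implicit Types (a b s t : S) (e f g : E).

Lemma Ltilde_starP a (e : S) : E e -> Ltilde E a e <-> star HE a = e.
Proof.
move=> Ee; split=> [ae|<-]; first exact/esym/star_unique.
exact: star_Ltilde.
Qed.

Definition class_obj (e : E) : D_obj E :=
  DObj (ex_intro2 _ _ (val e) (set_valP e) erefl).

Lemma in_class (e : E) a : (a \in D_set (class_obj e)) <-> star HE a = val e.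
Proof. by rewrite inE; apply: Ltilde_starP; apply: set_valP. Qed.

Lemma class_star (e : E) (x : class_obj e) : star HE (val x) = val e.
Proof. exact/in_class/valP. Qed.

Lemma mul_class (e : E) (x : class_obj e) : val x * val e = val x.
Proof. by rewrite -(class_star x) mul_star. Qed.

Definition class_elt (e : E) a (ae : star HE a = val e) : class_obj e :=
  Sub a ((in_class e a).2 ae).

Lemma class_obj_inj : injective class_obj.
Proof.
move=> e f ef; apply: val_inj; rewrite -(star_id HE (set_valP e)).
by apply/in_class; rewrite -ef; apply/in_class/star_id/set_valP.
Qed.

Lemma D_obj_ext (X Y : D_obj E) : D_set X = D_set Y -> X = Y.
Proof.
case: X Y => [X XP] [Y YP] /= XY.
by case: Y / XY YP => YP; rewrite (Prop_irrelevance XP YP).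
Qed.

Lemma class_obj_surj (X : D_obj E) : exists e, class_obj e = X.
Proof.
have [e Ee eX] := D_setP X.
by exists (Sub e (mem_set Ee)); apply: D_obj_ext; rewrite eX.
Qed.

Lemma class_act_definedP (e : E) s (x : class_obj e) :
  isSome (pact (Ltilde_action (class_obj e)) s x) <->
  star HE (s * val x) = val e.
Proof. by rewrite -in_class isSome_insub. Qed.

Lemma class_actP (e : E) s (x y : class_obj e) :
  pact (Ltilde_action (class_obj e)) s x = Some y <-> s * val x = val y.
Proof.
split=> [|sx]; last by rewrite /= /Ltilde_act sx valK.
by rewrite /= /Ltilde_act; case: insubP => // u _ <- [->].
Qed.

(** * Right multiplications are the morphisms *)

Lemma pact_hom_ext (X Y : partial_action S) (F G : pact_hom X Y) :
  sval F =1 sval G -> F = G.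
Proof. by case: F G => F ? [G ?] /= /funext; apply: eq_exist. Qed.

Lemma codom_mul e f (a : C_hom HE e f) : val f * sval a = sval a.
Proof. by have [_ {1}<-] := svalP a; rewrite mul_plus. Qed.

(** Right multiplication by [a : e -> f] reverses direction: it sends the class
of [f] into the class of [e], because [(t * a)^* = (f * a)^* = a^*] as soon as
[t^* = f]. *)
Lemma star_mul_eq (e f : E) (a : C_hom HE e f) t :
  star HE t = val f -> star HE (t * sval a) = val e.
Proof. by move=> tf; rewrite starM // tf codom_mul; case: (svalP a). Qed.

(** The generalized right ample identity at the idempotents [e = t^*] and
[f = a^*]. Since [(e * a)^* = (t * a)^* = f], also [(e * a * f)^* = f], and
[a * f = a], so that the identity becomes [(e * a^+)^* = a^+]. Its left side is
[(t * a^+)^* = t^*]. *)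
Lemma star_cancel (HA : generalized_right_ample HE) a t :
  t * plus HE a = t -> star HE (t * a) = star HE a -> star HE t = plus HE a.
Proof.
move=> ta ta_star.
have sta : star HE (star HE t * a) = star HE a by rewrite -starM.
have := HA a _ _ (starE HE t) (starE HE a).
by rewrite -mulgA mul_star sta mul_star -starM // ta.
Qed.

Definition rmul (e f : E) (a : C_hom HE e f) (x : class_obj f) : class_obj e :=
  class_elt (star_mul_eq a (class_star x)).

(** Equivariance is associativity. If [s * x] stays in the class of [f], then
[s * x * a] stays in the class of [e] by [star_mul_eq]; the converse is
[star_cancel] at [t = s * x]. *)
Lemma rmul_hom (HA : generalized_right_ample HE) (e f : E) (a : C_hom HE e f) :
  @is_pact_hom S (Ltilde_action (class_obj f)) (Ltilde_action (class_obj e))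
    (rmul a).
Proof.
move=> s x; split; last first.
  by move=> y /class_actP sx; apply/class_actP; rewrite /= mulgA sx.
rewrite !class_act_definedP /= mulgA.
split=> [|sxa]; first exact: star_mul_eq.
case: a sxa => a [ae af] /= sxa; apply: (etrans _ af); apply: star_cancel => //.
  by rewrite af -mulgA mul_class.
by rewrite sxa.
Qed.

Definition class_unit (f : E) : class_obj f :=
  class_elt (star_id HE (set_valP f)).

Section Full.
Variables (e f : E) (F : D_hom (class_obj f) (class_obj e)).

(** As [x * f = x], the partial map [x] is defined at [f] with value [x];
equivariance at this point determines the morphism from its value at [f]. *)
Lemma hom_rmul (x : class_obj f) :
  val (sval F x) = val x * val (sval F (class_unit f)).
Proof.
have xu : pact (Ltilde_action (class_obj f)) (val x) (class_unit f) = Some x.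
  by apply/class_actP; apply: mul_class.
by have [_ /(_ x xu)/class_actP] := svalP F (val x) (class_unit f).
Qed.

(** Let [a] be the image of [f]. Then [f * a = a] gives [f * a^+ = a^+], hence
[a^+ * f = a^+] because [E] is reduced. Now [a^+ * a = a] lies in the target
class, so [a^+] is defined at [a]; a morphism reflects definedness, so
[a^+ * f = a^+] lies in the class of [f], and an element of [E] in that class
is [f]. *)
Lemma hom_unit_plus : plus HE (val (sval F (class_unit f))) = val f.
Proof.
set a := val _; have Ef : E (val f) := set_valP f.
have fa : val f * a = a by exact/esym/(hom_rmul (class_unit f)).
have ap_f : plus HE a * val f = plus HE a.
  apply: (fountain_reduced HE (Defs.plusE HE a) Ef).2.
  exact: (plus_Rtilde HE a Ef).1 fa.
have [H _] := svalP F (plus HE a) (class_unit f).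
rewrite -(star_id HE (Defs.plusE HE a)) -ap_f.
apply/(class_act_definedP _ (class_unit f))/H/class_act_definedP.
by rewrite mul_plus class_star.
Qed.

Definition hom_elt : C_hom HE e f :=
  exist _ (val (sval F (class_unit f)))
    (conj (class_star (sval F (class_unit f))) hom_unit_plus).

End Full.

(** * The functor *)

Hypothesis HA : generalized_right_ample HE.

Definition rmul_pact f e (a : C_hom HE e f) :
    D_hom (class_obj f) (class_obj e) :=
  exist _ (rmul a) (rmul_hom HA a).

Lemma rmul_pact1 e : rmul_pact (C_id HE e) = pact_id _.
Proof.
by apply: pact_hom_ext => x; apply/val_inj; apply: mul_class.
Qed.

Lemma rmul_pactM (g f e : E) (b : C_hom HE f g) (a : C_hom HE e f) :
  rmul_pact (C_comp HC b a) = pact_comp (rmul_pact a) (rmul_pact b).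
Proof.
by apply: pact_hom_ext => x; apply/val_inj; apply: mulgA.
Qed.

Definition rmul_functor :
    functor (opposite (C_category HE HC)) (D_category E) :=
  @Functor (opposite (C_category HE HC)) (D_category E) class_obj rmul_pact
    rmul_pact1 (fun g f e v u => rmul_pactM u v).

(** Evaluation at [f] recovers the multiplier: [f * a = a]. *)
Lemma rmul_pact_inj f e : injective (@rmul_pact f e).
Proof.
move=> a b ab; have /= := congr1 (fun F => val (sval F (class_unit f))) ab.
rewrite !codom_mul => eq_ab; case: a b eq_ab {ab} => a ? [b ?].
exact: eq_exist.
Qed.

Lemma rmul_pact_surj f e (F : D_hom (class_obj f) (class_obj e)) :
  rmul_pact (hom_elt F) = F.
Proof.
by apply: pact_hom_ext => x; apply/val_inj/esym/hom_rmul.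
Qed.

End RightMultiplication.

Theorem corollary3p9 (S : semigroupType) (E : set S)
    (HE : reduced_fountain E) (HC : congruence_condition E)
    (HA : generalized_right_ample HE) :
  isomorphic_categories (opposite (C_category HE HC)) (D_category E).
Proof.
have [g gK] := choice (@class_obj_surj S E).
apply: (@fully_faithful_iso _ _ (rmul_functor HC HA) g gK).
- exact: class_obj_inj HE.
- exact: rmul_pact_inj.
- by move=> f e F; exists (hom_elt HE F); apply: rmul_pact_surj.
Qed.
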